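(* Let $\Omega\subseteq\mathbb{R}^N$ be a nonempty open set with $|\Omega|<\infty$, let $0<m<1$, $(a,b)\in\mathbb{C}^2$ and $F\in L^2(\Omega)$. If $\mathrm{Re}(b)<0$, assume further that $\mathrm{Im}(b)\neq0$ or $-\frac{1}{C_{\mathrm P}^2}<\mathrm{Re}(b)$, where $C_{\mathrm P}$ is the Poincaré constant. Let $u\in H^1_0(\Omega)$ be any solution of $$-\Delta u+a|u|^{-(1-m)}u+bu=F\quad\text{in } L^2(\Omega).$$ Then $$\|u\|_{H^1_0(\Omega)}\le C,$$ where $C=C(\|F\|_{L^2(\Omega)},|\Omega|,|a|,|b|,N,m)$.
   Context: All functions are complex-valued. The expression $|u|^{-(1-m)}u$ is understood to be $0$ where $u=0$. $|\Omega|$ is the Lebesgue measure of $\Omega$. $C_{\mathrm P}=C_{\mathrm P}(|\Omega|,N)>0$ denotes the constant, depending only on $|\Omega|$ and $N$, in Poincaré's inequality $\|u\|_{L^2(\Omega)}\le C_{\mathrm P}\|\nabla u\|_{L^2(\Omega)}$ for all $u\in H^1_0(\Omega)$. The Laplacian is taken in the sense of distributions. The notation $C=C(p_1,\dots,p_n)$ means that the positive constant $C$ depends continuously and only on the parameters $p_1,\dots,p_n$.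
   Formalization: The constant C may also depend on max(0, −Re(b)), since dependence on |b| alone fails when Re(b)<0 (Ω=(0,π), a=0, b=−e^{−is}, u=c sin x, s→0); N≥1, and C_P is any positive Poincaré constant continuous in |Ω|. *)

(* Defs.v *)
From HB Require Import structures.
From mathcomp Require Import all_boot all_order all_algebra.
From mathcomp Require Import complex.
From mathcomp Require Import all_classical all_reals all_analysis.

Set Implicit Arguments.
Unset Strict Implicit.
Unset Printing Implicit Defensive.

Import Order.TTheory GRing.Theory Num.Theory.
Import numFieldNormedType.Exports.

Local Open Scope classical_set_scope.
Local Open Scope ring_scope.

(* 'rV[R]_n is measurable for its Borel sigma-algebra *)
Definition borel_rV_display : measure_display. Proof. exact. Qed.

Section borel_rV.
Variables (R : realType) (n : nat).

Let B : set_system 'rV[R]_n := <<s @open 'rV[R]_n >>.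

Let B0 : B set0. Proof. exact: sigma_algebra0. Qed.
Let BC A : B A -> B (~` A). Proof. exact: sigma_algebraC. Qed.
Let BU (F : (set 'rV[R]_n)^nat) : (forall i, B (F i)) -> B (\bigcup_i F i).
Proof. exact: sigma_algebra_bigcup. Qed.

HB.instance Definition _ := @isMeasurable.Build borel_rV_display 'rV[R]_n
  B B0 BC BU.

Lemma open_measurable_rV (U : set 'rV[R]_n) : open U -> measurable U.
Proof. exact: sub_sigma_algebra. Qed.
End borel_rV.

Section measurable_rV.
Context {R : realType}.

Lemma measurable_coord n (i : 'I_n) :
  measurable_fun [set: 'rV[R]_n] (fun v => v ord0 i).
Proof.
apply: (measurability _ (measurable_realfun.RGenOpens.measurableE R)).
move=> _ [_ [a [b ->] <-]]; rewrite setTI; apply: open_measurable_rV.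
apply: open_comp; last exact: interval_open.
by move=> v _; exact: coord_continuous.
Qed.

Lemma measurable_fun_rV d (T : measurableType d) n (f : T -> 'rV[R]_n) :
  (forall i, measurable_fun [set: T] (fun t => f t ord0 i)) ->
  measurable_fun [set: T] f.
Proof.
move=> mf; apply: (@measurability _ _ _ _ _ f (@open 'rV[R]_n)) => //.
move=> _ [U oU <-]; rewrite setTI.
pose B (p : 'rV[rat]_n * nat) : set 'rV[R]_n :=
  ball (map_mx ratr p.1 : 'rV[R]_n) p.2.+1%:R^-1.
have mB p : measurable (f @^-1` B p).
  rewrite (_ : _ @^-1` _ = \bigcap_(i in [set: 'I_n])
      (fun t => f t ord0 i) @^-1` ball (ratr (p.1 ord0 i) : R) p.2.+1%:R^-1).
    apply: fin_bigcap_measurable => // i _; rewrite -[X in measurable X]setTI.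
    by apply: mf => //; apply: measurable_realfun.open_measurable; exact: ball_open.
  apply/seteqP; split=> t /=.
    by move=> [_ Bt] i _ /=; have := Bt ord0 i; rewrite mxE.
  move=> Bt; split; first by rewrite invr_gt0.
  by move=> j i; rewrite ord1 mxE; exact: Bt.
rewrite (_ : f @^-1` U = \bigcup_p (if pselect (B p `<=` U)
    then f @^-1` B p else set0)).
  apply: countable_bigcupT_measurable; first exact: countableP.
  move=> p; case: (pselect (B p `<=` U)) => _ //=.
apply/seteqP; split=> t /=; last first.
  by move=> [p _]; case: pselect => // BU /BU.
move=> Ut; have [e /= e0 eU] : exists2 e : R, 0 < e & ball (f t) e `<=` U.
  by apply/nbhs_ballP; exact: open_nbhs_nbhs.
have [k ke] : exists k, k.+1%:R^-1 < e / 2.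
  have [k] := ltr_add_invr (divr_gt0 e0 (ltr0n R 2)).
  by rewrite add0r; exists k.
have k0 : 0 < k.+1%:R^-1 :> R by rewrite invr_gt0.
have qP i : exists q : rat, `|f t ord0 i - ratr q| < k.+1%:R^-1.
  have /rat_in_itvoo[q] : f t ord0 i - k.+1%:R^-1 < f t ord0 i + k.+1%:R^-1.
    by rewrite ltrBlDr -addrA ltrDl addr_gt0.
  by rewrite in_itv/= -ltr_distlC; exists q.
have [q fq] := choice qP.
exists (\row_i q i, k) => //.
have Bt : B (\row_i q i, k) (f t).
  by split=> // j i; rewrite !mxE /ball/= ord1 distrC.
case: pselect => // nBU; exfalso; apply: nBU => y qy.
apply: eU; rewrite [e]splitr.
apply: (@ball_triangle _ _ (map_mx ratr (\row_i q i) : 'rV[R]_n)).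
  by apply: (le_ball (ltW ke)); apply: ball_sym.
exact: (le_ball (ltW ke)).
Qed.

Definition rV_cons n (p : R * 'rV[R]_n) : 'rV[R]_n.+1 :=
  row_mx (const_mx p.1 : 'rV_1) p.2.

Lemma measurable_rV_cons n : measurable_fun [set: R * 'rV[R]_n] (@rV_cons n).
Proof.
apply: measurable_fun_rV => i.
case: (split_ordP (i : 'I_(1 + n))) => j ->.
  apply: eq_measurable_fun measurable_fst => p _.
  by rewrite [RHS](@row_mxEl _ 1 1 n) mxE.
apply: eq_measurable_fun (measurableT_comp (measurable_coord j) measurable_snd).
by move=> p _; rewrite [RHS](@row_mxEr _ 1 1 n).
Qed.
End measurable_rV.

Section lebesgue_rV.
Context {R : realType}.

Section cons_measure.
Variables (n : nat) (mu : {sigma_finite_measure set 'rV[R]_n -> \bar R}).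

Definition cons_measure : set 'rV[R]_n.+1 -> \bar R :=
  pushforward (lebesgue_measure \x mu)%E (@rV_cons R n).

Let cons_measure0 : cons_measure set0 = 0%E.
Proof. by rewrite /cons_measure /pushforward preimage_set0 measure0. Qed.

Let cons_measure_ge0 A : (0 <= cons_measure A)%E.
Proof. exact: (measure_ge0 (lebesgue_measure \x mu)%E). Qed.

Let cons_measure_sigma_additive : semi_sigma_additive cons_measure.
Proof.
exact: (@measure_semi_sigma_additive _ _ _
  (measure_function_pushforward__canonical__measure_function_Measure
    (lebesgue_measure \x mu)%E (@measurable_rV_cons R n))).
Qed.

HB.instance Definition _ := isMeasure.Build _ _ _ cons_measure
  cons_measure0 cons_measure_ge0 cons_measure_sigma_additive.

Let cons_measure_sigma_finite : sigma_finite setT cons_measure.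
Proof.
have [F TF mF] : sigma_finite setT (lebesgue_measure \x mu)%E.
  have /sigma_finiteP[F [TF ndF Foo]] := sigma_finiteT (@lebesgue_measure R).
  have /sigma_finiteP[G [TG ndG Goo]] := sigma_finiteT mu.
  exists (fun k => F k `*` G k).
    apply/seteqP; split=> // -[x y] _.
    have [i _ Fx] : (\bigcup_i F i) x by rewrite -TF.
    have [j _ Gy] : (\bigcup_i G i) y by rewrite -TG.
    exists (maxn i j) => //; split.
      by move: x Fx; exact/subsetPset/ndF/leq_maxl.
    by move: y Gy; exact/subsetPset/ndG/leq_maxr.
  move=> k; have [mFk Fk] := Foo k; have [mGk Gk] := Goo k.
  split; first exact: measurableX.
  by rewrite product_measure1E// lte_mul_pinfty// ge0_fin_numE.
pose g (v : 'rV[R]_n.+1) : R * 'rV[R]_n :=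
  (v ord0 ord0, \row_j v ord0 (lift ord0 j)).
have gK : cancel (@rV_cons R n) g.
  move=> [x v]; congr pair.
    rewrite /rV_cons (_ : ord0 = lshift n (ord0 : 'I_1)); last exact/val_inj.
    by rewrite [LHS](@row_mxEl _ 1 1 n) mxE.
  apply/rowP => j; rewrite mxE /rV_cons.
  rewrite (_ : lift ord0 j = rshift 1 j); last exact/val_inj.
  by rewrite [LHS](@row_mxEr _ 1 1 n).
have mg : measurable_fun [set: 'rV[R]_n.+1] g.
  apply/measurable_fun_pairP; split; first exact: measurable_coord.
  apply: measurable_fun_rV => j.
  by apply: eq_measurable_fun (measurable_coord _) => v _ /=; rewrite mxE.
exists (fun k => g @^-1` F k).
  by rewrite -preimage_bigcup -TF preimage_setT.
move=> k; have [mFk Fk] := mF k; split.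
  by rewrite -[X in measurable X]setTI; exact: mg.
rewrite /cons_measure /pushforward -comp_preimage.
by rewrite (_ : g \o _ = id) //; exact/funext.
Qed.

HB.instance Definition _ := Measure_isSigmaFinite.Build _ _ _ cons_measure
  cons_measure_sigma_finite.
End cons_measure.

Fixpoint lebesgue_rV (n : nat) : {sigma_finite_measure set 'rV[R]_n -> \bar R} :=
  match n with
  | 0 => \d_(0 : 'rV[R]_0)
  | n'.+1 => cons_measure (lebesgue_rV n')
  end.

End lebesgue_rV.

Section lebesgue_rV_box.
Context {R : realType}.

Lemma lebesgue_rV_box n (A : 'I_n -> set R) : (forall i, measurable (A i)) ->
  lebesgue_rV n [set v | forall i, A i (v ord0 i)] =
  (\prod_(i < n) @lebesgue_measure R (A i))%E.
Proof.
elim: n A => [|n IH] A mA.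
  by rewrite big_ord0 /= diracE mem_set // => -[].
rewrite big_ord_recl -IH// -product_measure1E//.
  rewrite /= /cons_measure /pushforward; congr (product_measure1 _ _ _).
  apply/seteqP; split=> -[x v] /=.
    move=> Axv; split.
      have := Axv ord0.
      rewrite {2}(_ : ord0 = lshift n (ord0 : 'I_1)); last exact/val_inj.
      by rewrite /rV_cons (@row_mxEl _ 1 1 n) mxE.
    move=> i; have := Axv (lift ord0 i).
    rewrite {2}(_ : lift ord0 i = rshift 1 i); last exact/val_inj.
    by rewrite /rV_cons (@row_mxEr _ 1 1 n).
  move=> [/= Ax Av] i; case: (unliftP ord0 i) => [j|] ->.
    rewrite {2}(_ : lift ord0 j = rshift 1 j); last exact/val_inj.
    by rewrite /rV_cons (@row_mxEr _ 1 1 n).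
  rewrite {2}(_ : ord0 = lshift n (ord0 : 'I_1)); last exact/val_inj.
  by rewrite /rV_cons (@row_mxEl _ 1 1 n) mxE.
  exact: mA.
rewrite (_ : (fun x => _) = \bigcap_(i in [set: 'I_n])
    (fun v : 'rV[R]_n => v ord0 i) @^-1` A (lift ord0 i)).
  apply: fin_bigcap_measurable => // i _; rewrite -[X in measurable X]setTI.
  exact: measurable_coord.
by apply/seteqP; split=> v /= h i; [move=> _|]; exact: h.
Qed.
End lebesgue_rV_box.

Section function_spaces.
Context {R : realType}.
Local Notation C := R[i].

Definition cmod (z : C) : R := ComplexField.Normc.normc z.

Context {N : nat}.
Implicit Types (Omega : set 'rV[R]_N) (f g u phi : 'rV[R]_N -> C).
Implicit Types (Du : 'I_N -> 'rV[R]_N -> C).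

Definition cintegral Omega f : C :=
  Complex (\int[lebesgue_rV N]_(x in Omega) complex.Re (f x))
          (\int[lebesgue_rV N]_(x in Omega) complex.Im (f x)).

Definition L2 Omega f : Prop :=
  [/\ measurable_fun Omega (fun x => complex.Re (f x)),
      measurable_fun Omega (fun x => complex.Im (f x)) &
      (\int[lebesgue_rV N]_(x in Omega) (cmod (f x) ^+ 2)%:E < +oo)%E].

Definition L2norm Omega f : R :=
  Num.sqrt (\int[lebesgue_rV N]_(x in Omega) (cmod (f x) ^+ 2)).

Definition partial (i : 'I_N) (f : 'rV[R]_N -> R) : 'rV[R]_N -> R :=
  'D_(delta_mx ord0 i) f.

(* The iterated partial derivatives of every order exist and are continuous *)
Definition smooth (f : 'rV[R]_N -> R) : Prop :=
  forall s : seq 'I_N, let g := foldr partial f s in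
    continuous g /\ forall i x, derivable g x (delta_mx ord0 i).

Definition test_function Omega phi : Prop :=
  [/\ smooth (fun x => complex.Re (phi x)),
      smooth (fun x => complex.Im (phi x)),
      compact (closure [set x | phi x != 0]) &
      closure [set x | phi x != 0] `<=` Omega].

Definition cpartial (i : 'I_N) phi : 'rV[R]_N -> C := fun x =>
  Complex (partial i (fun y => complex.Re (phi y)) x)
          (partial i (fun y => complex.Im (phi y)) x).

Definition laplacian phi : 'rV[R]_N -> C := fun x =>
  \sum_(i < N) cpartial i (cpartial i phi) x.

Definition weak_gradient Omega u Du : Prop :=
  forall i phi, test_function Omega phi ->
    cintegral Omega (fun x => u x * cpartial i phi x) =
    - cintegral Omega (fun x => Du i x * phi x).

Definition grad_norm Omega Du : R :=
  Num.sqrt (\sum_(i < N) L2norm Omega (Du i) ^+ 2).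

(* The full H^1 norm; it dominates the L^2 norm of the gradient *)
Definition H1norm Omega u Du : R :=
  Num.sqrt (L2norm Omega u ^+ 2 + grad_norm Omega Du ^+ 2).

(* u is in H^1(Omega), with weak gradient Du (which u determines up to a null
   set), and is in the closure of the test functions for the H^1 norm *)
Definition H10 Omega u Du : Prop :=
  [/\ L2 Omega u, forall i, L2 Omega (Du i), weak_gradient Omega u Du &
      exists phi : nat -> 'rV[R]_N -> C,
        (forall n, test_function Omega (phi n)) /\
        (fun n => H1norm Omega (fun x => phi n x - u x)
                   (fun i x => cpartial i (phi n) x - Du i x))
          @ \oo --> (0 : R)].

(* Lu represents the distribution Laplacian(u) *)
Definition distributional_laplacian Omega u Lu : Prop :=
  forall phi, test_function Omega phi ->
    cintegral Omega (fun x => u x * laplacian phi x) =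
    cintegral Omega (fun x => Lu x * phi x).

(* |z|^{-(1-m)} z, extended by 0 at z = 0 *)
Definition singular_power (m : R) (z : C) : C :=
  if z == 0 then 0 else (cmod z `^ (- (1 - m)))%:C%C * z.

Definition solution Omega (m : R) (a b : C) F u : Prop :=
  exists Lu : 'rV[R]_N -> C,
    [/\ L2 Omega Lu, distributional_laplacian Omega u Lu &
        {ae lebesgue_rV N, forall x, Omega x ->
           - Lu x + a * singular_power m (u x) + b * u x = F x}].

End function_spaces.

Definition poincare_constant (R : realType) (CP : nat -> R -> R) : Prop :=
  forall N, (0 < N)%N ->
    [/\ forall V, 0 < V -> 0 < CP N V,
        {in `]0, +oo[, continuous (CP N)} &
        forall (Omega : set 'rV[R]_N) u Du,
          open Omega -> Omega !=set0 -> (lebesgue_rV N Omega < +oo)%E ->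
          H10 Omega u Du ->
          L2norm Omega u
          <= CP N (fine (lebesgue_rV N Omega)) * grad_norm Omega Du].

(* Range of the parameters (f, V, a, r, t, m) of the final bound, standing for
   (||F||, |Omega|, |a|, |b|, Re(b)^-, m) with Re(b)^- = max(0, - Re b). For
   t = Re(b)^- > 0, t < r says that Im(b) != 0, as r^2 = t^2 + Im(b)^2.
   When Re(b) < 0, |b| alone cannot control the bound: for Omega = ]0, pi[,
   a = 0, b = - e^(- i s) and u = c sin x, one has |b| = 1 and Im(b) != 0 for
   small s > 0, and ||F|| = 2 sin(s/2) ||u||, so u is unbounded for fixed
   ||F|| as s tends to 0. *)
Definition admissible (R : realType) (CP : nat -> R -> R) (N : nat) :
    set (R * R * R * R * R * R) :=
  [set p | let: (f, V, a, r, t, m) := p in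
    [/\ 0 <= f /\ 0 < V, 0 <= a, 0 <= t <= r,
        0 < t -> t < r \/ t < 1 / CP N V ^+ 2 & 0 < m < 1]].

(* Main.v *)
Require Import Defs.
From HB Require Import structures.
From mathcomp Require Import all_boot all_order all_algebra.
From mathcomp Require Import complex.
From mathcomp Require Import all_classical all_reals all_analysis.
From mathcomp Require Import measurable_realfun ring lra.

Set Implicit Arguments.
Unset Strict Implicit.
Unset Printing Implicit Defensive.

Import Order.TTheory GRing.Theory Num.Theory.
Import numFieldNormedType.Exports.

Local Open Scope classical_set_scope.
Local Open Scope ring_scope.

(** Test the equation with the conjugate of [u]. With
[X = ||Du||], [Y = ||u||] and [W] the integral of [|u|^(1+m)], the real and the
imaginary part read
<<
  X^2 + Re(a) W + Re(b) Y^2 = Re <F, u>,     Im(a) W + Im(b) Y^2 = Im <F, u>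
>>
([energy_balance]). Since [u] is only known to have a distributional Laplacian
in L^2, the first term comes from approximating [u] by test functions
([green]).

Put [G = |a| W + ||F|| Y], [t = max(0, - Re b)] and [P] the Poincare constant.
By the Cauchy-Schwarz inequality the real part gives [X^2 <= t Y^2 + G], hence
[(1/P^2 - t) Y^2 <= G] by Poincare's inequality, and the two parts together give
[sqrt(|b|^2 - t^2) Y^2 <= 2 G] ([sqrt_defect_le]). The hypothesis on [b] ensures
that one of these two coefficients is positive, so [k Y^2 <= 2 G] for
their maximum [k > 0] ([coercivity]). As [1 + m < 2] and the volume is finite,
Young's inequality absorbs [|a| W] into [k Y^2] up to a constant
([power_integral_young]); what is left is linear in [Y] and bounds it
([a_priori_estimate]). Then [X^2 <= t Y^2 + G] bounds the gradient.

The resulting bound is an explicit expression in [||F||], the volume, [|a|],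
[|b|], [t], [m] and [P], built from continuous functions with the positive
denominators [k], [1 - m], [a + 1] and [P], and so it is continuous on the set of
admissible parameters ([parameter_bound_continuous]). *)

(** * Real and imaginary parts, modulus *)

Section complex_modulus.
Context {R : realType}.
Implicit Types z w : R[i].

Lemma sqr_cmod z : cmod z ^+ 2 = complex.Re z ^+ 2 + complex.Im z ^+ 2.
Proof. by case: z => x y; rewrite /cmod sqr_sqrtr// addr_ge0// sqr_ge0. Qed.

Lemma cmod_ge0 z : 0 <= cmod z.
Proof. by case: z => x y; exact: sqrtr_ge0. Qed.

Lemma cmodM z w : cmod (z * w) = cmod z * cmod w.
Proof. exact: ComplexField.Normc.normcM. Qed.

Lemma cmod_conj z : cmod (conjc z) = cmod z.
Proof. by case: z => x y; rewrite /cmod /= sqrrN. Qed.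

Lemma normr_Re_le z : `|complex.Re z| <= cmod z.
Proof.
rewrite -(ler_pXn2r (ltn0Sn 1)) ?nnegrE ?cmod_ge0// real_normK ?num_real// sqr_cmod.
by rewrite lerDl sqr_ge0.
Qed.

Lemma normr_Im_le z : `|complex.Im z| <= cmod z.
Proof.
rewrite -(ler_pXn2r (ltn0Sn 1)) ?nnegrE ?cmod_ge0// real_normK ?num_real// sqr_cmod.
by rewrite lerDr sqr_ge0.
Qed.

Lemma ReD z w : complex.Re (z + w) = complex.Re z + complex.Re w.
Proof. by case: z w => [? ?] [? ?]. Qed.
Lemma ImD z w : complex.Im (z + w) = complex.Im z + complex.Im w.
Proof. by case: z w => [? ?] [? ?]. Qed.
Lemma ReN z : complex.Re (- z) = - complex.Re z.
Proof. by case: z => [? ?]. Qed.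
Lemma ImN z : complex.Im (- z) = - complex.Im z.
Proof. by case: z => [? ?]. Qed.
Lemma ReM z w : complex.Re (z * w) =
  complex.Re z * complex.Re w - complex.Im z * complex.Im w.
Proof. by case: z w => [? ?] [? ?]. Qed.
Lemma ImM z w : complex.Im (z * w) =
  complex.Re z * complex.Im w + complex.Im z * complex.Re w.
Proof. by case: z w => [? ?] [? ?]. Qed.
Lemma Re_conjc z : complex.Re (conjc z) = complex.Re z.
Proof. by case: z. Qed.
Lemma Im_conjc z : complex.Im (conjc z) = - complex.Im z.
Proof. by case: z. Qed.

Lemma complex_ext z w : complex.Re z = complex.Re w ->
  complex.Im z = complex.Im w -> z = w.
Proof. by case: z w => [? ?] [? ?] /= -> ->. Qed.

Lemma cmodD z w : cmod (z + w) <= cmod z + cmod w.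
Proof. exact: le_normcD. Qed.

Lemma cmodN z : cmod (- z) = cmod z.
Proof. exact: normcN. Qed.

Lemma cmod_sum n (f : 'I_n -> R[i]) :
  cmod (\sum_(i < n) f i) <= \sum_(i < n) cmod (f i).
Proof.
elim/big_ind2 : _ => [|x1 x2 y1 y2 H1 H2|//].
  by rewrite /cmod ComplexField.Normc.normc0.
exact: le_trans (cmodD _ _) (lerD H1 H2).
Qed.

Lemma cmod_le_Re_Im z : cmod z <= `|complex.Re z| + `|complex.Im z|.
Proof.
rewrite -(ler_pXn2r (ltn0Sn 1)) ?nnegrE ?cmod_ge0 ?addr_ge0//.
rewrite sqr_cmod sqrrD !real_normK ?num_real// addrAC lerDl.
by rewrite mulrn_wge0// mulr_ge0.
Qed.

Lemma cmod_eq0 z : cmod z = 0 -> z = 0.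
Proof. exact: ComplexField.Normc.eq0_normc. Qed.

Lemma Re_mul_conj z : complex.Re (z * conjc z) = cmod z ^+ 2.
Proof. by rewrite ReM Re_conjc Im_conjc mulrN opprK sqr_cmod !expr2. Qed.

Lemma Im_mul_conj z : complex.Im (z * conjc z) = 0.
Proof. by rewrite ImM Re_conjc Im_conjc mulrN mulrC addNr. Qed.

Lemma Re_sum n (z : 'I_n -> R[i]) :
  complex.Re (\sum_(i < n) z i) = \sum_(i < n) complex.Re (z i).
Proof. exact: (big_morph _ ReD (erefl _)). Qed.

Lemma Im_sum n (z : 'I_n -> R[i]) :
  complex.Im (\sum_(i < n) z i) = \sum_(i < n) complex.Im (z i).
Proof. exact: (big_morph _ ImD (erefl _)). Qed.

End complex_modulus.

(** * Square-integrable functions and the Cauchy-Schwarz inequality *)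

(** The discriminant of a quadratic polynomial that is nonnegative everywhere
is nonpositive; [A = 0] is the degenerate case of an affine polynomial. *)
Lemma sqr_le_of_quadratic (K : realFieldType) (I A B : K) : 0 <= A ->
  (forall s, 2 * s * I <= s ^+ 2 * A + B) -> I ^+ 2 <= A * B.
Proof.
rewrite le_eqVlt => /predU1P[<-|A0] H.
  rewrite mul0r; have [->|I0] := eqVneq I 0; first by rewrite expr0n.
  (* at this point the affine polynomial takes the value - 1 *)
  have := H ((B + 1) / (2 * I)); rewrite mulr0 add0r.
  by rewrite (_ : 2 * _ * I = B + 1) ?gerDl ?ler10//; field.
have := H (I / A).
rewrite (_ : 2 * (I / A) * I = 2 * (I ^+ 2 / A)); last by field; rewrite gt_eqF.
rewrite (_ : (I / A) ^+ 2 * A = I ^+ 2 / A); last by field; rewrite gt_eqF.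
rewrite mulr_natl mulr2n lerD2l ler_pdivrMr//.
by rewrite (mulrC A).
Qed.

Section L2_theory.
Context {R : realType} {N : nat} {Omega : set 'rV[R]_N}.
Hypothesis mOmega : measurable Omega.
Local Notation mu := (lebesgue_rV N).
Implicit Types f g h : 'rV[R]_N -> R[i].

Definition cintegrable f :=
  mu.-integrable Omega (EFin \o (fun x => complex.Re (f x))) /\
  mu.-integrable Omega (EFin \o (fun x => complex.Im (f x))).

Definition cmeasurable f :=
  measurable_fun Omega (fun x => complex.Re (f x)) /\
  measurable_fun Omega (fun x => complex.Im (f x)).

Lemma L2_cmeasurable f : L2 Omega f -> cmeasurable f.
Proof. by case. Qed.

Lemma measurable_cmod_sqr f : cmeasurable f ->
  measurable_fun Omega (fun x => cmod (f x) ^+ 2).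
Proof.
move=> [mr mi]; under eq_fun do rewrite sqr_cmod.
by apply: measurable_funD; exact: measurable_funX.
Qed.

Lemma measurable_cmod f : cmeasurable f ->
  measurable_fun Omega (fun x => cmod (f x)).
Proof.
move=> /measurable_cmod_sqr mf.
rewrite (_ : (fun x => _) = (fun x => Num.sqrt (cmod (f x) ^+ 2))); last first.
  by apply/funext => x; rewrite sqrtr_sqr ger0_norm ?cmod_ge0.
apply: measurableT_comp mf; apply: continuous_measurable_fun.
exact: sqrt_continuous.
Qed.

Lemma cmeasurableM f g : cmeasurable f -> cmeasurable g ->
  cmeasurable (fun x => f x * g x).
Proof.
move=> [fr fi] [gr gi]; split.
  under eq_fun do rewrite ReM.
  by apply: measurable_funB; exact: measurable_funM.
under eq_fun do rewrite ImM.
by apply: measurable_funD; exact: measurable_funM.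
Qed.

Lemma cmeasurableB f g : cmeasurable f -> cmeasurable g ->
  cmeasurable (fun x => f x - g x).
Proof.
move=> [fr fi] [gr gi]; split.
  under eq_fun do rewrite ReD ReN.
  exact: measurable_funB.
under eq_fun do rewrite ImD ImN.
exact: measurable_funB.
Qed.

Lemma cmeasurable_conj f : cmeasurable f -> cmeasurable (fun x => conjc (f x)).
Proof.
move=> [fr fi]; split; first by under eq_fun do rewrite Re_conjc.
under eq_fun do rewrite Im_conjc.
exact: measurableT_comp.
Qed.

Lemma L2_sqr_integrable f : L2 Omega f ->
  mu.-integrable Omega (EFin \o (fun x => cmod (f x) ^+ 2)).
Proof.
move=> Lf; have [_ _ foo] := Lf; apply/integrableP; split.
  by apply/measurable_EFinP; exact: (measurable_cmod_sqr (L2_cmeasurable Lf)).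
by under eq_integral do rewrite gee0_abs ?lee_fin ?sqr_ge0//.
Qed.

Lemma L2P f : cmeasurable f ->
  mu.-integrable Omega (EFin \o (fun x => cmod (f x) ^+ 2)) -> L2 Omega f.
Proof.
move=> [mr mi] /integrableP[_ foo]; split => //; move: foo.
by under eq_integral do rewrite gee0_abs ?lee_fin ?sqr_ge0//.
Qed.

Lemma le_integrable_EFin (f g : 'rV[R]_N -> R) : measurable_fun Omega f ->
  mu.-integrable Omega (EFin \o g) ->
  (forall x, Omega x -> `|f x| <= g x) -> mu.-integrable Omega (EFin \o f).
Proof.
move=> mf ig fg; apply: (le_integrable mOmega _ _ ig).
  exact/measurable_EFinP.
by move=> x Ox /=; rewrite lee_fin (le_trans (fg x Ox))// ler_norm.
Qed.

Lemma integrableD_EFin (f g : 'rV[R]_N -> R) :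
  mu.-integrable Omega (EFin \o f) -> mu.-integrable Omega (EFin \o g) ->
  mu.-integrable Omega (EFin \o (fun x => f x + g x)).
Proof. by move=> fi gi; exact: (integrableD mOmega fi gi). Qed.

Lemma integrableZ_EFin (f : 'rV[R]_N -> R) k :
  mu.-integrable Omega (EFin \o f) ->
  mu.-integrable Omega (EFin \o (fun x => k * f x)).
Proof. by move=> fi; exact: (integrableZl mOmega k fi). Qed.

Lemma L2B f g : L2 Omega f -> L2 Omega g -> L2 Omega (fun x => f x - g x).
Proof.
move=> Lf Lg; have mfg := cmeasurableB (L2_cmeasurable Lf) (L2_cmeasurable Lg).
apply: L2P => //.
have sf := L2_sqr_integrable Lf; have sg := L2_sqr_integrable Lg.
apply: (le_integrable_EFin (measurable_cmod_sqr mfg)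
  (integrableD_EFin (integrableZ_EFin 2 sf) (integrableZ_EFin 2 sg))) => x _.
rewrite ger0_norm ?sqr_ge0// !sqr_cmod ReD ReN ImD ImN.
set p := complex.Re _; set q := complex.Re _.
set r := complex.Im _; set s := complex.Im _.
have := sqr_ge0 (p + q); have := sqr_ge0 (r + s); lra.
Qed.

Lemma L2_conj f : L2 Omega f -> L2 Omega (fun x => conjc (f x)).
Proof.
move=> Lf; apply: L2P; first exact: (cmeasurable_conj (L2_cmeasurable Lf)).
rewrite (_ : (fun x => _) = (fun x => cmod (f x) ^+ 2)).
  exact: L2_sqr_integrable.
by apply/funext => x; rewrite cmod_conj.
Qed.

Lemma L2norm_conj f : L2norm Omega (fun x => conjc (f x)) = L2norm Omega f.
Proof. by rewrite /L2norm; under eq_Rintegral do rewrite cmod_conj. Qed.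

Lemma L2norm_ge0 f : 0 <= L2norm Omega f.
Proof. exact: sqrtr_ge0. Qed.

Lemma sqr_L2norm f :
  L2norm Omega f ^+ 2 = \int[mu]_(x in Omega) (cmod (f x) ^+ 2).
Proof. by rewrite sqr_sqrtr// Rintegral_ge0// => x _; exact: sqr_ge0. Qed.

Lemma le_cmodM_integrable f g (h : 'rV[R]_N -> R) :
  L2 Omega f -> L2 Omega g -> measurable_fun Omega h ->
  (forall x, `|h x| <= cmod (f x) * cmod (g x)) ->
  mu.-integrable Omega (EFin \o h).
Proof.
move=> Lf Lg mh hfg.
have sf := L2_sqr_integrable Lf; have sg := L2_sqr_integrable Lg.
apply: (le_integrable_EFin mh (integrableD_EFin sf sg)) => x _.
apply: (le_trans (hfg x)).
have := sqr_ge0 (cmod (f x) - cmod (g x)).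
have := sqr_ge0 (cmod (f x) + cmod (g x)); lra.
Qed.

(** Integrating [2 s h <= s^2 |f|^2 + |g|^2] gives, for the integral [I] of
[h], [2 s I <= s^2 ||f||^2 + ||g||^2] for every real [s], and the discriminant
of this quadratic inequality is the claim. Allowing any [h] dominated by
[|f| |g|] covers the real and the imaginary part of [f g] at once. *)
Lemma cauchy_schwarz f g (h : 'rV[R]_N -> R) :
  L2 Omega f -> L2 Omega g -> measurable_fun Omega h ->
  (forall x, `|h x| <= cmod (f x) * cmod (g x)) ->
  `|\int[mu]_(x in Omega) h x| <= L2norm Omega f * L2norm Omega g.
Proof.
move=> Lf Lg mh hfg; have ih := le_cmodM_integrable Lf Lg mh hfg.
have sf := L2_sqr_integrable Lf; have sg := L2_sqr_integrable Lg.
rewrite -(ler_pXn2r (ltn0Sn 1)) ?nnegrE ?mulr_ge0 ?L2norm_ge0//.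
rewrite real_normK ?num_real// exprMn; apply: sqr_le_of_quadratic => [|s].
  exact: sqr_ge0.
rewrite !sqr_L2norm -!RintegralZl// -RintegralD//; last exact: integrableZ_EFin.
apply: le_Rintegral => //; first exact: integrableZ_EFin.
  exact: integrableD_EFin (integrableZ_EFin _ sf) sg.
move=> x _; have := sqr_ge0 (`|s| * cmod (f x) - cmod (g x)).
have : s * h x <= `|s| * (cmod (f x) * cmod (g x)).
  by apply: (le_trans (ler_norm _)); rewrite normrM ler_wpM2l.
have : `|s| ^+ 2 = s ^+ 2 by rewrite real_normK ?num_real.
move=> <-; rewrite sqrrB exprMn; lra.
Qed.

Lemma L2M_cintegrable f g :
  L2 Omega f -> L2 Omega g -> cintegrable (fun x => f x * g x).
Proof.
move=> Lf Lg.
have [mr mi] := cmeasurableM (L2_cmeasurable Lf) (L2_cmeasurable Lg).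
split; apply: (le_cmodM_integrable Lf Lg) => // x; rewrite -cmodM.
  exact: normr_Re_le.
exact: normr_Im_le.
Qed.

Lemma normr_Re_cintegralM_le f g : L2 Omega f -> L2 Omega g ->
  `|complex.Re (cintegral Omega (fun x => f x * g x))|
  <= L2norm Omega f * L2norm Omega g.
Proof.
move=> Lf Lg.
have [mr mi] := cmeasurableM (L2_cmeasurable Lf) (L2_cmeasurable Lg).
by apply: cauchy_schwarz => // x; rewrite -cmodM; exact: normr_Re_le.
Qed.

Lemma normr_Im_cintegralM_le f g : L2 Omega f -> L2 Omega g ->
  `|complex.Im (cintegral Omega (fun x => f x * g x))|
  <= L2norm Omega f * L2norm Omega g.
Proof.
move=> Lf Lg.
have [mr mi] := cmeasurableM (L2_cmeasurable Lf) (L2_cmeasurable Lg).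
by apply: cauchy_schwarz => // x; rewrite -cmodM; exact: normr_Im_le.
Qed.

Lemma cmod_cintegralM_le f g : L2 Omega f -> L2 Omega g ->
  cmod (cintegral Omega (fun x => f x * g x))
  <= 2 * (L2norm Omega f * L2norm Omega g).
Proof.
move=> Lf Lg; apply: (le_trans (cmod_le_Re_Im _)).
have := normr_Re_cintegralM_le Lf Lg.
have := normr_Im_cintegralM_le Lf Lg; lra.
Qed.

Lemma cintegralD f g : cintegrable f -> cintegrable g ->
  cintegral Omega (fun x => f x + g x) = cintegral Omega f + cintegral Omega g.
Proof.
move=> [fr fi] [gr gi]; apply: complex_ext; rewrite ?ReD ?ImD /=.
  by rewrite -RintegralD//; apply: eq_Rintegral => x _; rewrite ReD.
by rewrite -RintegralD//; apply: eq_Rintegral => x _; rewrite ImD.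
Qed.

Lemma cintegralB f g : cintegrable f -> cintegrable g ->
  cintegral Omega (fun x => f x - g x) = cintegral Omega f - cintegral Omega g.
Proof.
move=> [fr fi] [gr gi]; apply: complex_ext; rewrite ?ReD ?ImD ?ReN ?ImN /=.
  by rewrite -RintegralB//; apply: eq_Rintegral => x _; rewrite ReD ReN.
by rewrite -RintegralB//; apply: eq_Rintegral => x _; rewrite ImD ImN.
Qed.

Lemma cintegral_sum n (f : 'I_n -> 'rV[R]_N -> R[i]) :
  (forall i, cintegrable (f i)) ->
  cintegral Omega (fun x => \sum_(i < n) f i x) =
  \sum_(i < n) cintegral Omega (f i).
Proof.
move=> fi.
(* the induction needs integrability of the partial sums *)
suff [//] : cintegrable (fun x => \sum_(i < n) f i x) /\
  cintegral Omega (fun x => \sum_(i < n) f i x) =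
  \sum_(i < n) cintegral Omega (f i).
elim: n f fi => [|n IH] f fi.
  under eq_fun do rewrite big_ord0.
  rewrite big_ord0 /cintegral /cintegrable/= Rintegral_cst// mul0r.
  by split=> //; split; exact: (integrable0 mu Omega).
under eq_fun do rewrite big_ord_recr/=.
have [IH1 IH2] := IH (fun i => f (widen_ord (leqnSn n) i)) (fun=> fi _).
rewrite big_ord_recr/= cintegralD// IH2; split=> //.
have [r1 i1] := IH1; have [r2 i2] := fi ord_max.
split.
  under eq_fun do rewrite /= ReD.
  exact: integrableD_EFin.
under eq_fun do rewrite /= ImD.
exact: integrableD_EFin.
Qed.

End L2_theory.

(** * Test functions *)

Section test_functions.
Context {R : realType} {N : nat}.
Implicit Types (Omega : set 'rV[R]_N) (phi : 'rV[R]_N -> R[i]).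

Lemma smooth_partial i (f : 'rV[R]_N -> R) : smooth f -> smooth (partial i f).
Proof. by move=> sf s /=; rewrite -foldr_rcons; exact: sf. Qed.

Lemma smoothN (f : 'rV[R]_N -> R) : smooth f -> smooth (fun x => - f x).
Proof.
move=> sf s; suff -> : foldr partial (fun x => - f x) s =
    (fun x => - foldr partial f s x).
  have [cf df] := sf s; split=> [x|i x]; first exact/continuousN/cf.
  exact/derivableN/df.
elim: s => //= i s ->; apply/funext => x.
by rewrite /partial deriveN//; exact: (sf s).2.
Qed.

Lemma test_function_conj Omega phi : test_function Omega phi ->
  test_function Omega (fun x => conjc (phi x)).
Proof.
move=> [sr si cK KO].
have etrans_smooth (f g : 'rV[R]_N -> R) : f =1 g -> smooth g -> smooth f.
  by move=> /funext ->.
have suppE : [set x | conjc (phi x) != 0] = [set x | phi x != 0].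
  by apply/seteqP; split=> x /=; rewrite conjc_eq0.
split.
- by apply: etrans_smooth sr => x; rewrite Re_conjc.
- by apply: etrans_smooth (smoothN si) => x; rewrite Im_conjc.
- by rewrite suppE.
- by rewrite suppE.
Qed.

Lemma partial_near0 i (f : 'rV[R]_N -> R) x :
  (\near x, f x = 0) -> partial i f x = 0.
Proof.
move=> f0; rewrite /partial (@near_eq_derive _ _ _ _ (cst 0))//.
exact: derive_cst.
Qed.

(** Off the support, [phi] vanishes on a neighbourhood, so its difference
quotients vanish as well. *)
Lemma support_cpartial i phi :
  [set x | cpartial i phi x != 0] `<=` closure [set x | phi x != 0].
Proof.
move=> x /=; apply: contraNP => nx.
have phi0 : \near x, phi x = 0.
  have : nbhs x (~` closure [set x | phi x != 0]).
    by apply: open_nbhs_nbhs; split=> //; exact/closed_openC/closed_closure.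
  apply: filterS => y ny; apply/eqP/negPn/negP => y0; apply: ny.
  exact: subset_closure.
apply/eqP; apply: complex_ext => /=; apply: partial_near0;
  by apply: filterS phi0 => y ->.
Qed.

Lemma test_function_cpartial Omega i phi : test_function Omega phi ->
  test_function Omega (cpartial i phi).
Proof.
move=> [sr si cK KO].
have sK : closure [set x | cpartial i phi x != 0] `<=`
    closure [set x | phi x != 0].
  rewrite ((closure_id _).1 (@closed_closure _ [set x | phi x != 0])).
  exact/closure_subset/support_cpartial.
split; [exact: smooth_partial|exact: smooth_partial| |exact: subset_trans KO].
by apply: subclosed_compact cK sK; exact: closed_closure.
Qed.

Lemma cpartial_conj i phi x :
  smooth (fun x => complex.Im (phi x)) ->
  cpartial i (fun x => conjc (phi x)) x = conjc (cpartial i phi x).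
Proof.
move=> si; apply: complex_ext => /=.
  by under eq_fun do rewrite Re_conjc.
under eq_fun do rewrite Im_conjc.
by rewrite /partial deriveN//; exact: (si [::]).2.
Qed.

Lemma continuous_measurable_rV (f : 'rV[R]_N -> R) :
  continuous f -> measurable_fun setT f.
Proof.
move=> cf; apply: (measurability _ (RGenOpens.measurableE R)).
move=> _ [_ [a [b ->] <-]]; rewrite setTI; apply: open_measurable_rV.
by apply: open_comp; [move=> v _; exact: cf|exact: interval_open].
Qed.

Lemma compact_support_bounded (K : set 'rV[R]_N) (f : 'rV[R]_N -> R) :
  compact K -> continuous f -> (forall x, ~ K x -> f x = 0) ->
  exists M, forall x, `|f x| <= M.
Proof.
move=> cK cf f0.
have : compact (f @` K) by apply: continuous_compact => //; exact: continuous_subspaceT.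
move=> /(@compact_bounded _ R^o) [M [_ HM]].
exists (`|M| + 1) => x; have M1 : M < `|M| + 1.
  by rewrite (le_lt_trans (ler_norm _))// ltrDl.
have [Kx|nKx] := pselect (K x); first by apply: (HM _ M1); exists x.
by rewrite f0// normr0 addr_ge0.
Qed.

(** A test function is continuous with compact support, hence bounded, and
[Omega] has finite measure. *)
Lemma test_function_L2 Omega phi : measurable Omega ->
  (lebesgue_rV N Omega < +oo)%E -> test_function Omega phi -> L2 Omega phi.
Proof.
move=> mO finO [sr si cK KO].
have phi0 x : ~ closure [set x | phi x != 0] x -> phi x = 0.
  by move=> nx; apply/eqP/negPn/negP => x0; apply/nx/subset_closure.
have cr : continuous (fun x => complex.Re (phi x)) := (sr [::]).1.
have ci : continuous (fun x => complex.Im (phi x)) := (si [::]).1.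
have [Mr HMr] : exists M, forall x, `|complex.Re (phi x)| <= M.
  by apply: (compact_support_bounded cK cr) => x /phi0 /= ->.
have [Mi HMi] : exists M, forall x, `|complex.Im (phi x)| <= M.
  by apply: (compact_support_bounded cK ci) => x /phi0 /= ->.
have mphi : @cmeasurable R N Omega phi.
  by split; apply: measurable_funTS; exact: continuous_measurable_rV.
apply: L2P => //.
have iM : (lebesgue_rV N).-integrable Omega (EFin \o cst (Mr ^+ 2 + Mi ^+ 2)).
  by apply: measurable_bounded_integrable => //; exact: bounded_cst.
apply: (le_integrable_EFin mO (measurable_cmod_sqr mphi) iM) => x _ /=.
rewrite ger0_norm ?sqr_ge0// sqr_cmod -real_normK ?num_real//.
rewrite -[X in _ + X <= _]real_normK ?num_real//.
by apply: lerD; rewrite ler_pXn2r// nnegrE (le_trans _ (HMr x), le_trans _ (HMi x)).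
Qed.

End test_functions.

(** * Green's identity *)

(** A nonempty open set contains a ball of the sup norm, which is a product of
intervals of positive length. *)
Lemma open_lebesgue_rV_gt0 (R : realType) n (Omega : set 'rV[R]_n) :
  open Omega -> Omega !=set0 -> (0 < lebesgue_rV n Omega)%E.
Proof.
move=> oO [x Ox].
have [e /= e0 eO] : exists2 e : R, 0 < e & ball x e `<=` Omega.
  by apply/nbhs_ballP; exact: open_nbhs_nbhs.
pose A (i : 'I_n) := ball (x ord0 i : R) e.
have mA i : measurable (A i) by exact: measurable_ball.
have mbox : measurable [set v : 'rV[R]_n | forall i, A i (v ord0 i)].
  rewrite (_ : [set v | _] = \bigcap_(i in [set: 'I_n])
      (fun v : 'rV[R]_n => v ord0 i) @^-1` A i); last first.
    by apply/seteqP; split=> v /= h i; [move=> _|]; exact: h.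
  apply: fin_bigcap_measurable => // i _; rewrite -[X in measurable X]setTI.
  exact: measurable_coord.
apply: (@lt_le_trans _ _ (lebesgue_rV n [set v | forall i, A i (v ord0 i)])).
  rewrite lebesgue_rV_box//.
  elim/big_ind : _ => [|y z y0 z0|i _]; [exact: lte01|exact: mule_gt0|].
  by rewrite /A lebesgue_measure_ball ?ltW// lte_fin mulrn_wgt0.
apply: le_measure; rewrite ?inE//; first exact: open_measurable_rV.
by move=> v /= Av; apply: eO; split=> // i j; rewrite ord1; exact: Av.
Qed.

Section green.
Context {R : realType} {N : nat} {Omega : set 'rV[R]_N}.
Hypothesis oOmega : open Omega.
Hypothesis finOmega : (lebesgue_rV N Omega < +oo)%E.
Local Notation mu := (lebesgue_rV N).
Implicit Types (u Lu F phi : 'rV[R]_N -> R[i]) (Du : 'I_N -> 'rV[R]_N -> R[i]).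

Let mOmega : measurable Omega. Proof. exact: open_measurable_rV. Qed.

Lemma eq_cintegral f g : f =1 g ->
  cintegral Omega f = cintegral Omega g :> R[i].
Proof. by move=> /funext ->. Qed.

(** Each second derivative in the distributional Laplacian is a first
derivative of the test function [cpartial i phi], to which the definition of
the weak gradient applies. *)
Lemma weak_laplacian_test u Du Lu phi : L2 Omega u -> weak_gradient Omega u Du ->
  distributional_laplacian Omega u Lu -> test_function Omega phi ->
  cintegral Omega (fun x => Lu x * phi x) =
  - \sum_(i < N) cintegral Omega (fun x => Du i x * cpartial i phi x).
Proof.
move=> Lu2 wg dl tphi; rewrite -dl// /laplacian.
under eq_fun do rewrite mulr_sumr.
have tp i : test_function Omega (cpartial i phi).
  exact: test_function_cpartial.
rewrite cintegral_sum// => [|i].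
  by rewrite -sumrN; apply: eq_bigr => i _; rewrite wg.
by apply: L2M_cintegrable => //; exact/test_function_L2/test_function_cpartial.
Qed.

Lemma weak_laplacian_conj_test u Du Lu phi :
  L2 Omega u -> weak_gradient Omega u Du ->
  distributional_laplacian Omega u Lu -> test_function Omega phi ->
  cintegral Omega (fun x => Lu x * conjc (phi x)) =
  - \sum_(i < N) cintegral Omega (fun x => Du i x * conjc (cpartial i phi x)).
Proof.
move=> Lu2 wg dl tphi.
rewrite (weak_laplacian_test Lu2 wg dl (test_function_conj tphi)).
apply: (congr1 -%R).
apply: eq_bigr => i _.
apply: eq_cintegral => x.
by rewrite cpartial_conj//; case: tphi.
Qed.

Lemma cintegral_mul_conj f :
  cintegral Omega (fun x => f x * conjc (f x)) =
  Complex (L2norm Omega f ^+ 2) 0 :> R[i].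
Proof.
apply: complex_ext => /=.
  by rewrite sqr_L2norm; apply: eq_Rintegral => x _; rewrite Re_mul_conj.
rewrite (_ : (fun x => _) = cst 0).
  by rewrite Rintegral_cst// mul0r.
by apply/funext => x; rewrite Im_mul_conj.
Qed.

Lemma L2norm_le_H1norm u Du : L2norm Omega u <= H1norm Omega u Du.
Proof.
rewrite -[leLHS]ger0_norm ?L2norm_ge0// -sqrtr_sqr; apply: ler_wsqrtr.
by rewrite lerDl sqr_ge0.
Qed.

Lemma sqr_grad_norm Du :
  grad_norm Omega Du ^+ 2 = \sum_(i < N) L2norm Omega (Du i) ^+ 2.
Proof. by rewrite sqr_sqrtr// sumr_ge0// => i _; exact: sqr_ge0. Qed.

Lemma L2norm_grad_le_H1norm u Du i :
  L2norm Omega (Du i) <= H1norm Omega u Du.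
Proof.
rewrite -[leLHS]ger0_norm ?L2norm_ge0// -sqrtr_sqr; apply: ler_wsqrtr.
rewrite sqr_grad_norm (bigD1 i)//= addrCA lerDl addr_ge0 ?sqr_ge0//.
by rewrite sumr_ge0// => j _; exact: sqr_ge0.
Qed.

Lemma cintegral_conjB f g h : L2 Omega f -> L2 Omega g -> L2 Omega h ->
  cintegral Omega (fun x => f x * conjc (g x - h x)) =
  cintegral Omega (fun x => f x * conjc (g x)) -
  cintegral Omega (fun x => f x * conjc (h x)) :> R[i].
Proof.
move=> Lf Lg Lh; rewrite -(cintegralB mOmega).
- by apply: eq_cintegral => x; rewrite rmorphB mulrBr.
- by apply: L2M_cintegrable => //; exact: L2_conj.
- by apply: L2M_cintegrable => //; exact: L2_conj.
Qed.

(** For a test function [psi] in place of [u], the equality of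
[int Lu conj(psi)] and [- sum_i int Du_i conj(d_i psi)] is the definition of
the weak derivatives. Approximating [u] by test functions [phi n] in the H^1
norm, both sides converge by Cauchy-Schwarz: the defect [Z] of the identity for
[u] is expressed through [phi n - u] alone, and so is bounded by a constant
times the H^1 norm of [phi n - u]. *)
Lemma green u Du Lu : H10 Omega u Du -> L2 Omega Lu ->
  distributional_laplacian Omega u Lu ->
  cintegral Omega (fun x => Lu x * conjc (u x)) =
  Complex (- grad_norm Omega Du ^+ 2) 0.
Proof.
move=> [Lu2 LDu wg [phi [tphi cphi]]] LLu dl.
pose d n := H1norm Omega (fun x => phi n x - u x)
  (fun i x => cpartial i (phi n) x - Du i x).
pose Z := cintegral Omega (fun x => Lu x * conjc (u x)) +
  \sum_(i < N) cintegral Omega (fun x => Du i x * conjc (Du i x)).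
pose K := 2 * L2norm Omega Lu + \sum_(i < N) 2 * L2norm Omega (Du i).
have Lphi n : L2 Omega (phi n) by exact: test_function_L2.
have Ldphi n i : L2 Omega (cpartial i (phi n)).
  exact/test_function_L2/test_function_cpartial.
have ZE n : Z = - (cintegral Omega (fun x => Lu x * conjc (phi n x - u x)) +
    \sum_(i < N) cintegral Omega
      (fun x => Du i x * conjc (cpartial i (phi n) x - Du i x))).
  rewrite cintegral_conjB//; under eq_bigr do rewrite cintegral_conjB//.
  rewrite sumrB (weak_laplacian_conj_test Lu2 wg dl (tphi n)).
  by rewrite addrACA addNr add0r -opprD opprK.
have Zle n : cmod Z <= K * d n.
  rewrite (ZE n) cmodN mulrDl mulr_suml.
  apply: (le_trans (cmodD _ _)); apply: lerD.
    apply: (le_trans (cmod_cintegralM_le _ _ _)) => //.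
      by apply: L2_conj => //; exact: L2B.
    rewrite -mulrA ler_pM2l// ler_wpM2l ?L2norm_ge0// L2norm_conj.
    exact: L2norm_le_H1norm.
  apply: (le_trans (cmod_sum _)); apply: ler_sum => i _.
  apply: (le_trans (cmod_cintegralM_le _ _ _)) => //.
    by apply: L2_conj => //; exact: L2B.
  rewrite -mulrA ler_pM2l// ler_wpM2l ?L2norm_ge0// L2norm_conj.
  exact: (@L2norm_grad_le_H1norm _ (fun i x => _) i).
have Z0 : Z = 0.
  apply/cmod_eq0/eqP; rewrite eq_le cmod_ge0 andbT.
  have Kd : (fun n => K * d n) @ \oo --> K * 0 by exact: cvgMr.
  rewrite -[leRHS](mulr0 K).
  by apply: (cvgr_to_ge Kd); exact: nearW.
move: Z0; rewrite /Z; under eq_bigr do rewrite cintegral_mul_conj.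
move=> /eqP; rewrite addr_eq0 => /eqP ->; apply: complex_ext.
  by rewrite ReN Re_sum sqr_grad_norm.
by rewrite ImN Im_sum/= big1// oppr0.
Qed.

End green.

(** * The energy balance *)

Lemma singular_power_mul_conj (R : realType) (m : R) (z : R[i]) : -1 < m ->
  singular_power m z * conjc z = (cmod z `^ (1 + m))%:C%C.
Proof.
move=> m1; have m0 : 1 + m != 0 by rewrite gt_eqF//; lra.
rewrite /singular_power; have [->|z0] := eqVneq z 0.
  by rewrite mul0r /cmod ComplexField.Normc.normc0 powR0.
have c0 : 0 < cmod z.
  rewrite lt_neqAle cmod_ge0 andbT eq_sym.
  by apply/eqP => /ComplexField.Normc.eq0_normc /eqP; rewrite (negbTE z0).
rewrite -mulrA (_ : z * conjc z = (cmod z ^+ 2)%:C%C); last first.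
  by apply: complex_ext; rewrite ?Re_mul_conj ?Im_mul_conj.
rewrite -rmorphM -powR_mulrn ?cmod_ge0// -powRD; last first.
  by rewrite (gt_eqF c0) implybT.
by congr (_ `^ _)%:C%C; ring.
Qed.

(** This is [eps] to the power [- (1 + m) / (1 - m)], the constant that Young's
inequality needs to absorb [x^(1+m)] into [eps x^2]. It is written with the
exponential, so that its continuity in both arguments is that of [expR] and
[ln]. *)
Definition young_const (R : realType) (eps m : R) : R :=
  expR (- ((1 + m) / (1 - m)) * ln eps).

(** The two terms on the right are each sufficient in one regime: [x^(1+m)] is
at most [eps x^2] once [x^(1-m) >= 1 / eps], and for smaller [x] it is at most
its value at the threshold. *)
Lemma powR_young (R : realType) (eps m x : R) : 0 < eps -> 0 < m < 1 -> 0 <= x ->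
  x `^ (1 + m) <= eps * x ^+ 2 + young_const eps m.
Proof.
move=> e0 /andP[m0 m1]; have y0 : 0 < young_const eps m by exact: expR_gt0.
rewrite le_eqVlt => /predU1P[<-|x0].
  rewrite powR0 ?expr0n/= ?mulr0 ?add0r; first exact: ltW.
  by rewrite gt_eqF//; lra.
rewrite /powR gt_eqF//; have [H|H] := leP (- ln eps) ((1 - m) * ln x).
  apply: (@le_trans _ _ (eps * x ^+ 2)); last by rewrite lerDl ltW.
  rewrite -[in leRHS](lnK e0) -[in leRHS](lnK x0) -expRM_natl -expRD ler_expR.
  lra.
apply: (@le_trans _ _ (young_const eps m)); last first.
  by rewrite lerDr mulr_ge0 ?sqr_ge0// ltW.
rewrite ler_expR mulNr -mulrN -mulrA ler_wpM2l//; first lra.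
rewrite mulrC ler_pdivlMr; lra.
Qed.

Section energy_balance.
Context {R : realType} {N : nat} {Omega : set 'rV[R]_N}.
Hypothesis oOmega : open Omega.
Hypothesis finOmega : (lebesgue_rV N Omega < +oo)%E.
Local Notation mu := (lebesgue_rV N).
Local Notation V := (fine (mu Omega)).
Implicit Types (u Lu F phi : 'rV[R]_N -> R[i]) (Du : 'I_N -> 'rV[R]_N -> R[i]).

Let mOmega : measurable Omega. Proof. exact: open_measurable_rV. Qed.

Definition power_integral (m : R) u : R :=
  \int[mu]_(x in Omega) (cmod (u x) `^ (1 + m)).

Lemma power_integral_ge0 m u : 0 <= power_integral m u.
Proof. by apply: Rintegral_ge0 => x _; exact: powR_ge0. Qed.

Let integrable_cstO k : mu.-integrable Omega (EFin \o cst (k : R)).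
Proof. by apply: measurable_bounded_integrable => //; exact: bounded_cst. Qed.

Lemma measurable_power m u : L2 Omega u ->
  measurable_fun Omega (fun x => cmod (u x) `^ (1 + m)).
Proof.
move=> Lu; apply: (measurableT_comp (measurable_powR (1 + m))).
exact: measurable_cmod (L2_cmeasurable Lu).
Qed.

Lemma integrable_power m u : 0 < m < 1 -> L2 Omega u ->
  mu.-integrable Omega (EFin \o (fun x => cmod (u x) `^ (1 + m))).
Proof.
move=> m01 Lu.
apply: (le_integrable_EFin mOmega (measurable_power m Lu) (integrableD_EFin mOmega
  (integrableZ_EFin mOmega 1 (L2_sqr_integrable Lu))
  (integrable_cstO (young_const 1 m)))) => x _.
rewrite ger0_norm ?powR_ge0//.
by apply: powR_young; rewrite ?ltr01 ?cmod_ge0.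
Qed.

Lemma power_integral_young eps m u : 0 < eps -> 0 < m < 1 -> L2 Omega u ->
  power_integral m u <= eps * L2norm Omega u ^+ 2 + young_const eps m * V.
Proof.
move=> e0 m01 Lu; have su := L2_sqr_integrable Lu.
have iZ := integrableZ_EFin mOmega eps su.
rewrite sqr_L2norm -Rintegral_cst// -RintegralZl//.
rewrite -RintegralD//; last exact: integrable_cstO.
apply: le_Rintegral => //; first exact: integrable_power.
  exact: (integrableD_EFin mOmega iZ (integrable_cstO _)).
by move=> x _; apply: powR_young; rewrite ?cmod_ge0.
Qed.

Lemma ae_eq_Rintegral (f g : 'rV[R]_N -> R) :
  measurable_fun Omega f -> measurable_fun Omega g ->
  {ae mu, forall x, Omega x -> f x = g x} ->
  \int[mu]_(x in Omega) f x = \int[mu]_(x in Omega) g x.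
Proof.
move=> mf mg fg; congr fine; apply: ae_eq_integral => //.
- exact/measurable_EFinP.
- exact/measurable_EFinP.
- by apply: filterS fg => x fgx Ox; rewrite /= fgx.
Qed.

Lemma Rintegral_linear3 (f g h : 'rV[R]_N -> R) k l :
  mu.-integrable Omega (EFin \o f) -> mu.-integrable Omega (EFin \o g) ->
  mu.-integrable Omega (EFin \o h) ->
  \int[mu]_(x in Omega) (- f x + k * g x + l * h x) =
  - (\int[mu]_(x in Omega) f x) + k * (\int[mu]_(x in Omega) g x) +
  l * \int[mu]_(x in Omega) h x.
Proof.
move=> fi gi hi.
have fi' := integrableZ_EFin mOmega (-1) fi.
have gi' := integrableZ_EFin mOmega k gi.
have hi' := integrableZ_EFin mOmega l hi.
rewrite -mulN1r -!RintegralZl// -RintegralD// -RintegralD//.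
  by apply: eq_Rintegral => x _; rewrite mulN1r.
exact: integrableD_EFin.
Qed.

(** The equation is multiplied by the conjugate of [u] and integrated: the
nonlinear term becomes [|u|^(1+m)] and the Laplacian [- |Du|^2] by Green's
identity. As the integrals of [|u|^(1+m)], [|u|^2] and [|Du|^2] are real, the
complex identity splits into two real ones with the real and the imaginary
parts of [a] and [b] as coefficients. *)
Lemma energy_balance m a b F u Du : 0 < m < 1 ->
  L2 Omega F -> H10 Omega u Du -> solution Omega m a b F u ->
  complex.Re (cintegral Omega (fun x => F x * conjc (u x))) =
    grad_norm Omega Du ^+ 2 + complex.Re a * power_integral m u +
    complex.Re b * L2norm Omega u ^+ 2 /\
  complex.Im (cintegral Omega (fun x => F x * conjc (u x))) =
    complex.Im a * power_integral m u + complex.Im b * L2norm Omega u ^+ 2.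
Proof.
move=> m01 LF H [Lu [LLu dl eqF]]; have [L2u _ _ _] := H.
have gr := green oOmega finOmega H LLu dl.
have L2cu := L2_conj L2u.
have [Fr Fi] := L2M_cintegrable mOmega LF L2cu.
have [Lr Li] := L2M_cintegrable mOmega LLu L2cu.
have iw := integrable_power m01 L2u.
have isq := L2_sqr_integrable L2u.
have eqFu : {ae mu, forall x, Omega x -> F x * conjc (u x) =
    - (Lu x * conjc (u x)) + a * (cmod (u x) `^ (1 + m))%:C%C +
    b * (cmod (u x) ^+ 2)%:C%C}.
  apply: filterS eqF => x + Ox => /(_ Ox) <-.
  rewrite -singular_power_mul_conj; last by case/andP: m01 => ? _; lra.
  rewrite (_ : (cmod (u x) ^+ 2)%:C%C = u x * conjc (u x)).
    by rewrite !mulrDl mulNr !mulrA.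
  by apply: complex_ext; rewrite ?Re_mul_conj ?Im_mul_conj.
have mFEin (f : 'rV[R]_N -> R) : mu.-integrable Omega (EFin \o f) ->
    measurable_fun Omega f.
  by move=> /integrableP[/measurable_EFinP].
have m3 (f : 'rV[R]_N -> R) k l : mu.-integrable Omega (EFin \o f) ->
    measurable_fun Omega (fun x => - f x + k * cmod (u x) `^ (1 + m) +
      l * cmod (u x) ^+ 2).
  move=> fi; apply: measurable_funD; first apply: measurable_funD.
  - by apply: measurableT_comp => //; exact: mFEin fi.
  - exact: (mFEin _ (integrableZ_EFin mOmega k iw)).
  - exact: (mFEin _ (integrableZ_EFin mOmega l isq)).
split.
- transitivity (- complex.Re (cintegral Omega (fun x => Lu x * conjc (u x))) +
    complex.Re a * power_integral m u + complex.Re b * L2norm Omega u ^+ 2).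
    rewrite sqr_L2norm -Rintegral_linear3//; apply: ae_eq_Rintegral.
    + exact: mFEin.
    + exact: m3.
    + apply: filterS eqFu => x + Ox => /(_ Ox) ->.
      by rewrite !ReD ReN [complex.Re (a * _)]ReM [complex.Re (b * _)]ReM/= !mulr0 !subr0.
  by rewrite gr /= opprK.
- transitivity (- complex.Im (cintegral Omega (fun x => Lu x * conjc (u x))) +
    complex.Im a * power_integral m u + complex.Im b * L2norm Omega u ^+ 2).
    rewrite sqr_L2norm -Rintegral_linear3//; apply: ae_eq_Rintegral.
    + exact: mFEin.
    + exact: m3.
    + apply: filterS eqFu => x + Ox => /(_ Ox) ->.
      by rewrite !ImD ImN [complex.Im (a * _)]ImM [complex.Im (b * _)]ImM/= !mulr0 !add0r.
  by rewrite gr /= oppr0 add0r.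
Qed.

End energy_balance.

(** * The bound and its continuity in the parameters *)

Section bound.
Context {R : realType}.
Implicit Types P f V a r t m X Y W : R.

(** The quantity for which [coercivity P t r * ||u||^2] is controlled by the
lower order terms. The first entry is the gain from Poincare's inequality with
constant [P] over a zero-order term of size [- t]; the second is [|Im b|] when
[t = - Re b > 0] and [r = |b|]. Taking the maximum treats both alternatives
on [b] by one formula, which is continuous in the parameters. *)
Definition coercivity P t r : R :=
  Num.max (1 / P ^+ 2 - t) (Num.sqrt (r ^+ 2 - t ^+ 2)).

(** Half of the coercivity absorbs twice the nonlinear term, as
[2 a eps <= coercivity / 2]; [a + 1] instead of [a] allows [a = 0]. *)
Definition young_eps P a r t : R := coercivity P t r / (4 * (a + 1)).

Definition L2_bound P f V a r t m : R :=
  1 + 4 * (a * (young_const (young_eps P a r t) m * V) + f) / coercivity P t r.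

(** The bound [B] on [||u||] is inserted into the real part of the energy
balance, which then controls the gradient. *)
Definition H1_bound P f V a r t m : R :=
  let B := L2_bound P f V a r t m in
  Num.sqrt (B ^+ 2 + (t * B ^+ 2 +
    (a * (young_eps P a r t * B ^+ 2 + young_const (young_eps P a r t) m * V) +
     f * B))).

Lemma coercivity_gt0 P t r : 0 < P -> 0 <= t <= r ->
  (0 < t -> t < r \/ t < 1 / P ^+ 2) -> 0 < coercivity P t r.
Proof.
move=> P0 /andP[t0 tr] H; rewrite /coercivity lt_max subr_gt0 sqrtr_gt0.
have [t0'|tpos] := eqVneq t 0; first by rewrite t0' divr_gt0// exprn_gt0.
have [|tr'|->//] := H; first by rewrite lt_neqAle eq_sym tpos.
by apply/orP; right; rewrite subr_gt0 ltr_pXn2r ?nnegrE ?(le_trans t0).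
Qed.

Lemma young_const_gt0 (eps m : R) : 0 < young_const eps m.
Proof. exact: expR_gt0. Qed.

Lemma L2_bound_ge1 P f V a r t m : 0 <= f -> 0 <= V -> 0 <= a ->
  0 < coercivity P t r -> 1 <= L2_bound P f V a r t m.
Proof.
move=> f0 V0 a0 k0; rewrite lerDl divr_ge0 ?(ltW k0)// mulr_ge0//.
by rewrite addr_ge0// !mulr_ge0// ltW// young_const_gt0.
Qed.

Lemma H1_bound_gt0 P f V a r t m : 0 <= f -> 0 <= V -> 0 <= a -> 0 <= t ->
  0 < coercivity P t r -> 0 < H1_bound P f V a r t m.
Proof.
move=> f0 V0 a0 t0 k0; rewrite sqrtr_gt0.
have B0 : 0 < L2_bound P f V a r t m.
  by rewrite (lt_le_trans ltr01)// L2_bound_ge1.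
have e0 : 0 <= young_eps P a r t.
  by rewrite divr_ge0 ?(ltW k0)// mulr_ge0// addr_ge0.
have c0 := ltW (young_const_gt0 (young_eps P a r t) m).
have B20 := ltW (exprn_gt0 2 B0).
have fB0 := mulr_ge0 f0 (ltW B0).
rewrite ltr_pwDl ?exprn_gt0//; apply: addr_ge0; first exact: mulr_ge0.
by apply: addr_ge0 => //; apply: mulr_ge0 => //; apply: addr_ge0; exact: mulr_ge0.
Qed.

(** Here [X], [Y] and [W] stand for the norms of the gradient and of [u], and
for the integral of [|u|^(1+m)]. Either entry of the coercivity [k] gives
[k Y^2 <= 2 (a W + f Y)], and after Young's inequality
[k Y^2 <= 4 (a c V + f Y)]. For [Y >= 1] one may divide by [Y] and drop it from
the denominator of the constant term, which bounds [Y] without solving a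
quadratic equation. *)
Lemma a_priori_estimate P f V a r t m X Y W :
  0 < P -> 0 <= f -> 0 <= V -> 0 <= a -> 0 <= t -> 0 < coercivity P t r ->
  0 <= Y -> Y <= P * X ->
  X ^+ 2 <= t * Y ^+ 2 + (a * W + f * Y) ->
  Num.sqrt (r ^+ 2 - t ^+ 2) * Y ^+ 2 <= 2 * (a * W + f * Y) ->
  W <= young_eps P a r t * Y ^+ 2 + young_const (young_eps P a r t) m * V ->
  Num.sqrt (Y ^+ 2 + X ^+ 2) <= H1_bound P f V a r t m.
Proof.
move=> P0 f0 V0 a0 t0 k0 Y0 YX HX HS HW.
set k := coercivity P t r in k0 *; set e := young_eps P a r t in HW *.
set c := young_const e m in HW *; have c0 : 0 < c := young_const_gt0 _ _.
have e0 : 0 < e by rewrite divr_gt0// mulr_gt0//; lra.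
have G0 : 0 <= a * W + f * Y.
  have : 0 <= 2 * (a * W + f * Y).
    by apply: le_trans HS; rewrite mulr_ge0 ?sqr_ge0 ?sqrtr_ge0.
  lra.
have kY : k * Y ^+ 2 <= 2 * (a * W + f * Y).
  rewrite /k /coercivity.
  case: (leP (1 / P ^+ 2 - t) (Num.sqrt (r ^+ 2 - t ^+ 2))) => // _.
  have : Y ^+ 2 / P ^+ 2 <= X ^+ 2.
    rewrite ler_pdivrMr ?exprn_gt0// -exprMn mulrC ler_pXn2r// nnegrE//.
    exact: le_trans YX.
  by rewrite mulrBl div1r [_ * Y ^+ 2]mulrC; lra.
have ae : 4 * (a * e) <= k.
  rewrite /e /young_eps -/k (_ : 4 * _ = k * (a / (a + 1))); last first.
    by field; rewrite gt_eqF//; lra.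
  by rewrite ler_piMr ?(ltW k0)// ler_pdivrMr; lra.
have aW : a * W <= a * e * Y ^+ 2 + a * (c * V).
  by rewrite -mulrA -mulrDr ler_wpM2l.
have kY2 : k * Y ^+ 2 <= 4 * (a * (c * V) + f * Y).
  have : 4 * (a * e) * Y ^+ 2 <= k * Y ^+ 2 by rewrite ler_wpM2r ?sqr_ge0.
  lra.
have acV0 : 0 <= a * (c * V) by rewrite !mulr_ge0// ltW.
set B := L2_bound P f V a r t m.
have BE : B = 1 + 4 * (a * (c * V) + f) / k by [].
have YB : Y <= B.
  have [Y1|Y1] := leP Y 1.
    by rewrite (le_trans Y1)// L2_bound_ge1.
  rewrite BE -lerBlDl; apply: (@le_trans _ _ Y); first by rewrite gerBl.
  have Y0' := lt_trans ltr01 Y1.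
  rewrite ler_pdivlMr// -(ler_pM2r Y0') (_ : Y * k * Y = k * Y ^+ 2); last by ring.
  apply: (le_trans kY2); rewrite -mulrA ler_pM2l// mulrDl lerD2r.
  by rewrite ler_peMr// ltW.
have Y2B2 : Y ^+ 2 <= B ^+ 2 by rewrite ler_pXn2r// nnegrE (le_trans Y0).
apply: ler_wsqrtr; rewrite -/e -/c -/B; apply: lerD => //.
apply: (le_trans HX); apply: lerD; first exact: ler_wpM2l.
apply: lerD; last exact: ler_wpM2l.
rewrite ler_wpM2l// (le_trans HW)// lerD2r ler_wpM2l//.
exact: ltW.
Qed.

Lemma cvg_maxr T (F : set_system T) {FF : Filter F} (g h : T -> R) (x y : R) :
  g @ F --> x -> h @ F --> y ->
  (fun z => Num.max (g z) (h z)) @ F --> Num.max x y.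
Proof.
move=> gx hy; have maxE u v : Num.max u v = (u + v + `|u - v|) / 2 :> R.
  by rewrite maxr_absE.
rewrite maxE; under eq_fun do rewrite maxE.
by apply: cvgMl; apply: cvgD; [exact: cvgD|apply: cvg_norm; exact: cvgB].
Qed.

Lemma H1_bound_cvg T (F : set_system T) {FF : ProperFilter F}
    (P_ f_ V_ a_ r_ t_ m_ : T -> R) P f V a r t m :
  0 < P -> 0 <= a -> m < 1 -> 0 < coercivity P t r ->
  P_ @ F --> P -> f_ @ F --> f -> V_ @ F --> V -> a_ @ F --> a ->
  r_ @ F --> r -> t_ @ F --> t -> m_ @ F --> m ->
  (fun z => H1_bound (P_ z) (f_ z) (V_ z) (a_ z) (r_ z) (t_ z) (m_ z)) @ F -->
  H1_bound P f V a r t m.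
Proof.
move=> P0 a0 m1 k0 cP cf cV ca cr ct cm.
have csqr (g : T -> R) (x : R) : g @ F --> x -> (fun z => g z ^+ 2) @ F --> x ^+ 2.
  by move=> gx; rewrite expr2; under eq_fun do rewrite expr2; exact: cvgM.
have ck : (fun z => coercivity (P_ z) (t_ z) (r_ z)) @ F --> coercivity P t r.
  apply: cvg_maxr.
    apply: cvgB => //; apply: cvgMr; apply: cvgV; last exact: csqr.
    by rewrite expf_neq0// gt_eqF.
  apply: continuous_cvg; first exact: sqrt_continuous.
  by apply: cvgB; exact: csqr.
have ce : (fun z => young_eps (P_ z) (a_ z) (r_ z) (t_ z)) @ F -->
    young_eps P a r t.
  apply: cvgM => //; apply: cvgV; first by rewrite gt_eqF//; lra.
  by apply: cvgMr; apply: cvgD => //; exact: cvg_cst.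
have e0 : 0 < young_eps P a r t by rewrite divr_gt0// mulr_gt0//; lra.
have cc : (fun z => young_const (young_eps (P_ z) (a_ z) (r_ z) (t_ z)) (m_ z))
    @ F --> young_const (young_eps P a r t) m.
  apply: continuous_cvg; first exact: continuous_expR.
  apply: cvgM; last by apply: continuous_cvg => //; exact: continuous_ln.
  apply: cvgN; apply: cvgM; first by apply: cvgD => //; exact: cvg_cst.
  apply: cvgV; first by rewrite gt_eqF//; lra.
  by apply: cvgB => //; exact: cvg_cst.
have cB : (fun z => L2_bound (P_ z) (f_ z) (V_ z) (a_ z) (r_ z) (t_ z) (m_ z))
    @ F --> L2_bound P f V a r t m.
  apply: cvgD; first exact: cvg_cst.
  apply: cvgM; last by apply: cvgV => //; rewrite gt_eqF.
  by apply: cvgMr; apply: cvgD => //; apply: cvgM => //; exact: cvgM.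
apply: continuous_cvg; first exact: sqrt_continuous.
have cB2 := csqr _ _ cB.
apply: cvgD => //; apply: cvgD; first exact: cvgM.
apply: cvgD; last exact: cvgM.
by apply: cvgM => //; apply: cvgD; exact: cvgM.
Qed.

Definition parameter_bound (CP : nat -> R -> R) (N : nat)
    (p : R * R * R * R * R * R) : R :=
  let: (f, V, a, r, t, m) := p in H1_bound (CP N V) f V a r t m.

(** At an admissible parameter the coercivity is positive and [CP N] is
continuous at the volume, so the bound is continuous there even as a function
on the whole parameter space. *)
Lemma parameter_bound_continuous CP N : poincare_constant CP -> (0 < N)%N ->
  {within admissible CP N, continuous (parameter_bound CP N)}.
Proof.
move=> HCP N0; have [CP0 cCP _] := HCP N N0.
apply: continuous_in_subspaceT => p /set_mem.
case: p => [[[[[f V] a] r] t] m] [[f0 V0] a0 tr H /andP[m0 m1]].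
set p := (f, V, a, r, t, m).
have V_gt0 : CP N V > 0 by exact: CP0.
rewrite (_ : parameter_bound CP N = fun q => H1_bound (CP N q.1.1.1.1.2)
    q.1.1.1.1.1 q.1.1.1.1.2 q.1.1.1.2 q.1.1.2 q.1.2 q.2); last first.
  by apply/funext => -[[[[[? ?] ?] ?] ?] ?].
have c1 : (fun q : R * R * R * R * R * R => q.1) @ p --> p.1 by exact: cvg_fst.
have c2 : (fun q : R * R * R * R * R * R => q.1.1) @ p --> p.1.1.
  by apply: cvg_comp c1 _; exact: cvg_fst.
have c3 : (fun q : R * R * R * R * R * R => q.1.1.1) @ p --> p.1.1.1.
  by apply: cvg_comp c2 _; exact: cvg_fst.
have c4 : (fun q : R * R * R * R * R * R => q.1.1.1.1) @ p --> p.1.1.1.1.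
  by apply: cvg_comp c3 _; exact: cvg_fst.
have cV : (fun q : R * R * R * R * R * R => q.1.1.1.1.2) @ p --> V.
  by apply: cvg_comp c4 _; exact: cvg_snd.
apply: H1_bound_cvg => //.
- exact: coercivity_gt0.
- by apply: cvg_comp cV _; apply: cCP; rewrite in_itv/= V0.
- by apply: cvg_comp c4 _; exact: cvg_fst.
- by apply: cvg_comp c3 _; exact: cvg_snd.
- by apply: cvg_comp c2 _; exact: cvg_snd.
- by apply: cvg_comp c1 _; exact: cvg_snd.
- exact: cvg_snd.
Qed.

End bound.

(** * The two alternatives on [b], and the estimate *)

Section negative_part.
Context {R : realType}.
Implicit Types b : R[i].

Definition Re_neg b : R := Num.max 0 (- complex.Re b).

Lemma Re_neg_ge0 b : 0 <= Re_neg b.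
Proof. by rewrite le_max lexx. Qed.

Lemma opp_Re_neg_le b : - Re_neg b <= complex.Re b.
Proof. by rewrite lerNl le_max lexx orbT. Qed.

Lemma Re_neg_le_cmod b : Re_neg b <= cmod b.
Proof.
rewrite ge_max cmod_ge0 (le_trans _ (normr_Re_le b))//.
by rewrite -normrN ler_norm.
Qed.

Lemma Re_neg_lt_cmod b : complex.Im b <> 0 -> Re_neg b < cmod b.
Proof.
move=> /eqP b0; rewrite -(ltr_pXn2r (ltn0Sn 1)) ?nnegrE ?cmod_ge0 ?Re_neg_ge0//.
rewrite sqr_cmod (@le_lt_trans _ _ (complex.Re b ^+ 2))//; last first.
  by rewrite ltrDl lt_neqAle sqr_ge0 eq_sym sqrf_eq0 b0.
rewrite -[leRHS]real_normK ?num_real// ler_pXn2r ?nnegrE ?Re_neg_ge0//.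
by rewrite ge_max normr_ge0 -normrN ler_norm.
Qed.

(** If [Re b < 0], the square root is [|Im b|] and the second inequality is
enough. If [Re b >= 0] it is [|b|], at most [Re b + |Im b|], and the two
inequalities are added. The parameters [|b|] and the negative part of [Re b] do
not determine [|Im b|] in the second case, hence the factor 2. *)
Lemma sqrt_defect_le b (X2 Y2 G : R) : 0 <= X2 -> 0 <= Y2 ->
  X2 + complex.Re b * Y2 <= G -> `|complex.Im b| * Y2 <= G ->
  Num.sqrt (cmod b ^+ 2 - Re_neg b ^+ 2) * Y2 <= 2 * G.
Proof.
move=> X0 Y0 Hr Hi; have I0 := mulr_ge0 (normr_ge0 (complex.Im b)) Y0.
have [bneg|bpos] := ltP (complex.Re b) 0.
  have -> : Re_neg b = - complex.Re b by apply/max_idPr; lra.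
  rewrite sqrrN sqr_cmod addrC addKr sqrtr_sqr; lra.
have -> : Re_neg b = 0 by apply/max_idPl; lra.
rewrite expr0n subr0 sqrtr_sqr (ger0_norm (cmod_ge0 _)).
apply: (@le_trans _ _ ((complex.Re b + `|complex.Im b|) * Y2)); last first.
  by rewrite mulrDl; lra.
rewrite ler_wpM2r// -(ler_pXn2r (ltn0Sn 1)) ?nnegrE ?cmod_ge0 ?addr_ge0//.
rewrite sqr_cmod sqrrD real_normK ?num_real// addrAC lerDl.
by rewrite mulrn_wge0// mulr_ge0.
Qed.

End negative_part.

Theorem theorem2p3 (R : realType) (CP : nat -> R -> R) :
  poincare_constant CP ->
  exists C : nat -> R * R * R * R * R * R -> R,
    (forall N, (0 < N)%N ->
       {within admissible CP N, continuous (C N)} /\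
       forall p, admissible CP N p -> 0 < C N p) /\
    forall (N : nat) (Omega : set 'rV[R]_N) (m : R) (a b : R[i])
           (F u : 'rV[R]_N -> R[i]) (Du : 'I_N -> 'rV[R]_N -> R[i]),
      (0 < N)%N ->
      open Omega -> Omega !=set0 -> (lebesgue_rV N Omega < +oo)%E ->
      0 < m < 1 ->
      L2 Omega F ->
      (complex.Re b < 0 ->
         complex.Im b <> 0 \/
         - (1 / CP N (fine (lebesgue_rV N Omega)) ^+ 2) < complex.Re b) ->
      H10 Omega u Du ->
      solution Omega m a b F u ->
      H1norm Omega u Du <=
        C N (L2norm Omega F, fine (lebesgue_rV N Omega), cmod a, cmod b,
             Num.max 0 (- complex.Re b), m).
Proof.
move=> HCP; exists (parameter_bound CP); split.
  move=> N N0; have [CP0 _ _] := HCP N N0.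
  split; first exact: parameter_bound_continuous.
  move=> [[[[[f V] a] r] t] m] [[f0 V0] a0 tr H _].
  have /andP[t0 _] := tr.
  by apply: H1_bound_gt0 => //; [exact: ltW|apply: coercivity_gt0 => //; exact: CP0].
move=> N Omega m a b F u Du N0 oO O0 finO m01 LF Hb H Hsol.
have [CP0 _ /(_ Omega u Du oO O0 finO H) poincare] := HCP N N0.
set V := fine _ in poincare Hb *.
have V0 : 0 < V by rewrite fine_gt0// open_lebesgue_rV_gt0.
have P0 := CP0 _ V0; have [L2u _ _ _] := H.
rewrite -/(Re_neg b) /parameter_bound.
have t0 := Re_neg_ge0 b; have tr := Re_neg_le_cmod b.
have k0 : 0 < coercivity (CP N V) (Re_neg b) (cmod b).
  apply: coercivity_gt0; rewrite ?t0// => tpos.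
  have bneg : complex.Re b < 0 by move: tpos; rewrite lt_max ltxx oppr_gt0.
  have [/Re_neg_lt_cmod|bP] := Hb bneg; [by left|right].
  by rewrite /Re_neg gt_max divr_gt0 ?exprn_gt0//= ltrNl.
have [Hre Him] := energy_balance oO finO m01 LF H Hsol.
have W0 := @power_integral_ge0 R N Omega m u.
have fY := normr_Re_cintegralM_le (open_measurable_rV oO) LF (L2_conj L2u).
have fYi := normr_Im_cintegralM_le (open_measurable_rV oO) LF (L2_conj L2u).
move: fY fYi; rewrite L2norm_conj Hre Him.
have := L2norm_ge0 (Omega := Omega) u; have := L2norm_ge0 (Omega := Omega) F.
set Y := L2norm Omega u in poincare *; set f := L2norm Omega F.
set X := grad_norm Omega Du in poincare *; set W := power_integral _ _ in W0 *.
move=> f0 Y0 fY fYi.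
have aW (c : R) : `|c| <= cmod a -> `|c * W| <= cmod a * W.
  by move=> ca; rewrite normrM (ger0_norm W0) ler_wpM2r.
have Hr : X ^+ 2 + complex.Re b * Y ^+ 2 <= cmod a * W + f * Y.
  have := aW _ (normr_Re_le a); move: fY; rewrite !ler_norml; lra.
have Hi : `|complex.Im b| * Y ^+ 2 <= cmod a * W + f * Y.
  rewrite -[X in _ * X]ger0_norm ?sqr_ge0// -normrM.
  have := aW _ (normr_Im_le a); move: fYi; rewrite !ler_norml; lra.
have X20 := sqr_ge0 X; have Y20 := sqr_ge0 Y.
apply: (@a_priori_estimate _ _ _ _ _ _ _ _ X Y W) => //.
- exact: ltW.
- exact: cmod_ge0.
- have : - Re_neg b * Y ^+ 2 <= complex.Re b * Y ^+ 2.
    by rewrite ler_wpM2r// opp_Re_neg_le.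
  lra.
- exact: sqrt_defect_le Hr Hi.
- apply: power_integral_young => //.
  by rewrite divr_gt0// mulr_gt0// ltr_wpDl ?cmod_ge0.
Qed.
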